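(* There exist three distinct finite connected graphs $H_1,H_2,H_3$ such that the set $\{H_1,H_2,H_3\}$ is forcing, but for all $1\le i<j\le 3$ the pair $\{H_i,H_j\}$ is not forcing.
   Context: All graphs are finite and simple (undirected, no loops, no multiple edges). For graphs $H,G$, let $\hom(H,G)$ be the number of graph homomorphisms from $H$ to $G$, i.e. maps $V(H)\to V(G)$ sending edges to edges. Graph sequences $\mathcal{G}=\{G_n\}$ are indexed by $n$ with $|V(G_n)|=n$. Write $t_{\mathcal{G}}(H)=\lim_{n\to\infty}\hom(H,G_n)/n^{|V(H)|}$ when the limit exists. The sequence $\mathcal{G}$ is quasirandom (with density $p$) if for every graph $H$ we have $\hom(H,G_n)=(p^{|E(H)|}+o(1))\,n^{|V(H)|}$; this is one of the standard equivalent characterisations due to Chung, Graham and Wilson. A set of graphs $\mathcal{H}$ is forcing if for every sequence of graphs $\{G_n\}$ with $|V(G_n)|=n$ and every constant $p\in(0,1)$, the following implication holds: if $\hom(H,G_n)=(p^{|E(H)|}+o(1))\,n^{|V(H)|}$ for every $H\in\mathcal{H}$, then $\{G_n\}$ is quasirandom with density $p$. *)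

(* Defs.v *)
From HB Require Import structures.
From mathcomp Require Import all_boot all_order all_algebra.
From mathcomp Require Import all_classical all_reals all_analysis.

Set Implicit Arguments.
Unset Strict Implicit.
Unset Printing Implicit Defensive.

Import Order.TTheory GRing.Theory Num.Theory.
Import numFieldNormedType.Exports.

Local Open Scope classical_set_scope.
Local Open Scope ring_scope.

Record sgraph := SGraph {
  vertex :> finType;
  adj : rel vertex;
  adj_sym : symmetric adj;
  adj_irrefl : irreflexive adj }.

Definition edges (G : sgraph) : {set {set G}} :=
  [set [set x; y] | x in G, y in adj x]%SET.

(* The null graph is not connected. *)
Definition connected_graph (G : sgraph) : Prop :=
  (0 < #|G|)%N /\ forall x y : G, connect (@adj G) x y.

Definition graph_iso (H G : sgraph) : Prop :=
  exists f : H -> G, bijective f /\ {mono f : x y / adj x y}.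

Definition is_graph_hom (H G : sgraph) (f : {ffun H -> G}) : bool :=
  [forall x, forall y, adj x y ==> adj (f x) (f y)].

Definition hom_count (H G : sgraph) : nat :=
  #|[set f | @is_graph_hom H G f]%SET|.

(* [hom_count H (G n) = (l + o(1)) * n ^ #|H|] as n tends to infinity.
   Dividing by [n ^ #|H|] is harmless: only n = 0 is degenerate. *)
Definition hom_asymp (R : realType) (H : sgraph) (G : nat -> sgraph) (l : R) :
    Prop :=
  (hom_count H (G n))%:R / n%:R ^+ #|H| @[n --> \oo] --> l.

Definition quasirandom (R : realType) (p : R) (G : nat -> sgraph) : Prop :=
  forall H : sgraph, hom_asymp H G (p ^+ #|edges H|).

(* Sets of graphs are predicates: the type [set sgraph] would be a universe
   inconsistency, as [sgraph] quantifies over [finType]. *)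
Definition forcing (R : realType) (Hs : sgraph -> Prop) : Prop :=
  forall G : nat -> sgraph, (forall n, #|G n| = n) ->
  forall p : R, 0 < p < 1 ->
  (forall H, Hs H -> hom_asymp H G (p ^+ #|edges H|)) ->
  quasirandom p G.

(* Main.v *)
Require Import Defs.
From mathcomp Require Import all_boot all_order all_algebra.
From mathcomp Require Import all_classical all_reals all_analysis.
From mathcomp Require Import ring lra zify.

Set Implicit Arguments.
Unset Strict Implicit.
Unset Printing Implicit Defensive.

Import Order.TTheory GRing.Theory Num.Theory.
Import numFieldNormedType.Exports.

Local Open Scope classical_set_scope.
Local Open Scope ring_scope.

(** The three graphs are the stars [K 1 4] and [K 1 8] and the 4-cycle [K 2 2].

    Why the triple is forcing.  Let [x] be the degree of a random vertex divided
    by the number of vertices.  The star counts say that the expectation of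
    [x ^+ 4] tends to [p ^+ 4] and that of [x ^+ 8] to [p ^+ 8], so the variance
    of [x ^+ 4] tends to 0: almost all degrees are close to [p * n].  Given that,
    the 4-cycle count is the smallest possible one, and the matrix [A - p], for
    [A] the adjacency matrix, has small 4-cycle norm ([C4_norm_le_counts]).  A
    matrix with small 4-cycle norm has small cut norm ([cut_le_C4_norm]), so the
    edges of any [H] can be replaced by the constant [p] one by one at a small
    cost each ([counting_lemma]).

    Why no pair is forcing.  All counterexamples are complete bipartite graphs
    with parts of sizes about [a * n] and [b * n], together with isolated
    vertices; there the density of [K s t] is
    [a ^+ s * b ^+ t + b ^+ s * a ^+ t] ([two_part_seq_asymp]).
    Two stars do not see more than the degrees, and [a = b = 1/2] gives a regular
    graph that is not quasirandom.  For the star [K 1 (4 * j)] and the 4-cycle one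
    has to solve [a * b ^+ (4 * j) + b * a ^+ (4 * j) = p ^+ (4 * j)] and
    [2 * (a * b) ^+ 2 = p ^+ 4].  Eliminating [p] and fixing the ratio [b / a]
    leaves an equation that is linear in [a]: scaling both parts multiplies the
    two sides by different powers, and adding isolated vertices is exactly such
    a scaling.  The ratio 3 gives [a = 3/14] for [j = 1] and [a = 27/547] for
    [j = 2].  The exponent 4 of the smaller star matters: [K 1 2] and the
    4-cycle do form a forcing pair. *)

(** * Homomorphism counts as sums of products over edges *)

(** Each edge is listed once, with its ends in the order of the enumeration of
    the vertices; this makes it possible to telescope over the edges. *)
Definition oriented_edges (H : sgraph) : {set H * H} :=
  [set z | adj z.1 z.2 & (enum_rank z.1 < enum_rank z.2)%N]%SET.

Lemma card_edges (H : sgraph) : #|edges H| = #|oriented_edges H|.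
Proof.
pose und (z : H * H) : {set H} := [set z.1; z.2]%SET.
have inj : {in oriented_edges H &, injective und}.
  move=> [x y] [x' y']; rewrite !inE /und /= => /andP[_ xy] /andP[_ xy'] /setP e.
  have := e x; have := e y; rewrite !inE !eqxx orbT /=.
  move=> /esym yE /esym xE; case/orP: xE => /eqP ?; case/orP: yE => /eqP ?;
    subst x y => //; move: (xy); rewrite ?ltnn //.
  by move=> /(ltn_trans xy'); rewrite ltnn.
rewrite -(card_in_imset inj); congr #|pred_of_set _|.
apply/setP => e; apply/imset2P/imsetP.
- move=> [x y _ xy ->].
  have xy' : adj x y by [].
  have nxy : enum_rank x != enum_rank y :> nat.
    apply/eqP => /val_inj/enum_rank_inj exy.
    by move: xy'; rewrite exy adj_irrefl.
  case: ltngtP nxy => // lt _.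
  + by exists (x, y); rewrite // !inE xy' lt.
  + exists (y, x); first by rewrite !inE /= adj_sym xy' lt.
    by rewrite /und /= finset.setUC.
- by move=> [[x y]]; rewrite inE => /andP[/= xy _] ->; exists x y.
Qed.

Lemma is_graph_hom_oriented (H G : sgraph) (f : {ffun H -> G}) :
  is_graph_hom f = [forall (z | z \in oriented_edges H), adj (f z.1) (f z.2)].
Proof.
apply/forallP/forall_inP => [h [x y]|h x].
  by rewrite inE => /andP[/= xy _]; have /forallP/(_ y) := h x; rewrite xy.
apply/forallP => y; apply/implyP => xy.
case: (ltngtP (enum_rank x) (enum_rank y)) => [lt|gt|].
- by apply: (h (x, y)); rewrite inE /= xy lt.
- by rewrite adj_sym; apply: (h (y, x)); rewrite inE /= adj_sym xy gt.
- by move=> /val_inj/enum_rank_inj exy; move: xy; rewrite exy adj_irrefl.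
Qed.

Lemma hom_count_sum (R : realType) (H G : sgraph) :
  (hom_count H G)%:R =
  \sum_(f : {ffun H -> G})
    \prod_(z <- enum (oriented_edges H)) (adj (f z.1) (f z.2))%:R :> R.
Proof.
rewrite /hom_count -sum1dep_card natr_sum big_mkcond /=.
apply: eq_bigr => f _; rewrite is_graph_hom_oriented big_enum /=.
case: ifP => [/forallP h|/negbT].
  by rewrite big1 // => z; have /implyP := h z => /[apply] ->.
by rewrite negb_forall => /existsP[z];
  rewrite negb_imply => /andP[zE /negbTE az]; rewrite (bigD1 z) //= az mul0r.
Qed.

(** * Cut norm, 4-cycle norm and the counting lemma *)

Section FunctionUpdate.
Variables (R : realType) (V T : finType).

Definition upd (f : {ffun V -> T}) (x : V) (a : T) : {ffun V -> T} :=
  [ffun y => if y == x then a else f y].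

(** Resampling one coordinate of a uniformly random function leaves it uniform.
    The proof exchanges the new value with the old one, an involution. *)
Lemma sum_upd (x : V) (F : {ffun V -> T} -> R) :
  \sum_f \sum_a F (upd f x a) = #|T|%:R * \sum_f F f.
Proof.
pose swap (u : {ffun V -> T} * T) := (upd u.1 x u.2, u.1 x).
have swapK : involutive swap.
  move=> [f a]; rewrite /swap /=; congr pair; last by rewrite ffunE eqxx.
  by apply/ffunP => y; rewrite !ffunE; case: eqP => // ->.
rewrite pair_big /= (reindex_inj (inv_inj swapK)) /=.
rewrite mulr_sumr (eq_bigr (fun u => F u.1)); last first.
  by move=> [f a] _; congr F; have [] := swapK (f, a).
rewrite -(pair_big xpredT xpredT (fun f _ => F f)) /=.
by apply: eq_bigr => f _; rewrite sumr_const mulr_natl.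
Qed.

End FunctionUpdate.

(** The difference of the two sides is half the sum of the squares of
    [f i * g j - f j * g i] (Lagrange's identity). *)
Lemma sum_cauchy_schwarz (R : realType) (I : finType) (f g : I -> R) :
  (\sum_i f i * g i) ^+ 2 <= (\sum_i f i ^+ 2) * (\sum_i g i ^+ 2).
Proof.
rewrite -subr_ge0.
have -> : (\sum_i f i ^+ 2) * (\sum_i g i ^+ 2) - (\sum_i f i * g i) ^+ 2 =
   2^-1 * \sum_i \sum_j (f i * g j - f j * g i) ^+ 2.
  have e i j : (f i * g j - f j * g i) ^+ 2 =
    f i ^+ 2 * g j ^+ 2 + f j ^+ 2 * g i ^+ 2 - 2 * ((f i * g i) * (f j * g j)).
    by ring.
  set F2 := \sum_i f i ^+ 2; set G2 := \sum_i g i ^+ 2; set FG := \sum_i f i * g i.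
  rewrite (eq_bigr (fun i => f i ^+ 2 * G2 + g i ^+ 2 * F2 - 2 * FG * (f i * g i))).
    by rewrite sumrB big_split -!mulr_suml -mulr_sumr /= -/F2 -/G2 -/FG; field.
  move=> i _; rewrite (eq_bigr _ (fun j _ => e i j)) sumrB big_split /=.
  by rewrite -mulr_sumr -mulr_suml -!mulr_sumr -/F2 -/G2 -/FG; ring.
by rewrite mulr_ge0 ?invr_ge0 // sumr_ge0 // => i _; rewrite sumr_ge0 // => j _;
  rewrite sqr_ge0.
Qed.

Section CountingLemma.
Variables (R : realType) (T : finType).
Implicit Types (U W : T -> T -> R).

Definition C4_norm U : R := \sum_a \sum_a' (\sum_b U a b * U a' b) ^+ 2.

Lemma sqr_sum_le_card (F : T -> R) :
  (forall a, `|F a| <= 1) -> \sum_a F a ^+ 2 <= #|T|%:R.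
Proof.
move=> F1; rewrite -sum1_card natr_sum; apply: ler_sum => a _.
by rewrite -real_normK ?num_real // expr_le1.
Qed.

(** Cauchy-Schwarz twice.  The first application removes [g] and leaves the
    quadratic form of [f] with kernel [\sum_b U a b * U a' b]; the second one
    removes [f] and leaves the sum of the squares of that kernel.  The parameter
    [delta] stands for the fourth root of the normalised 4-cycle norm. *)
Lemma cut_le_C4_norm U (delta : R) (f g : T -> R) :
  0 <= delta -> C4_norm U <= delta ^+ 4 * #|T|%:R ^+ 4 ->
  (forall a, `|f a| <= 1) -> (forall b, `|g b| <= 1) ->
  `|\sum_a \sum_b U a b * f a * g b| <= delta * #|T|%:R ^+ 2.
Proof.
move=> d0 UD f1 g1; set S := \sum_a _; set n : R := #|T|%:R in UD *.
have n0 : 0 <= n by rewrite ler0n.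
pose K a a' := \sum_b U a b * U a' b.
have S2 : S ^+ 2 <= n * \sum_a \sum_a' (f a * f a') * K a a'.
  have -> : S = \sum_b g b * \sum_a U a b * f a.
    rewrite /S exchange_big /=; apply: eq_bigr => b _.
    by rewrite mulr_sumr; apply: eq_bigr => a _; ring.
  have -> : \sum_a \sum_a' (f a * f a') * K a a' =
            \sum_b (\sum_a U a b * f a) ^+ 2.
    transitivity (\sum_a \sum_a' \sum_b (U a b * f a) * (U a' b * f a')).
      apply: eq_bigr => a _; apply: eq_bigr => a' _; rewrite /K mulr_sumr.
      by apply: eq_bigr => b _; ring.
    under eq_bigr do rewrite exchange_big /=.
    rewrite exchange_big /=; apply: eq_bigr => b _; rewrite expr2 mulr_suml.
    by apply: eq_bigr => a _; rewrite mulr_sumr.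
  apply: le_trans (sum_cauchy_schwarz _ _) _.
  apply: ler_wpM2r; first by apply: sumr_ge0 => b _; rewrite sqr_ge0.
  exact: sqr_sum_le_card.
set Q := \sum_a _ in S2.
have Q2 : Q ^+ 2 <= n ^+ 2 * C4_norm U.
  rewrite /Q pair_big /=.
  apply: le_trans (sum_cauchy_schwarz (fun u => f u.1 * f u.2) (fun u => K u.1 u.2)) _.
  rewrite /C4_norm [X in _ <= _ * X]pair_big /=.
  apply: ler_wpM2r; first by apply: sumr_ge0 => b _; rewrite sqr_ge0.
  rewrite (eq_bigr (fun u => f u.1 ^+ 2 * f u.2 ^+ 2)); last by move=> u _; rewrite exprMn.
  rewrite -(pair_big xpredT xpredT (fun a a' => f a ^+ 2 * f a' ^+ 2)) /=.
  under eq_bigr do rewrite -mulr_sumr.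
  rewrite -mulr_suml expr2.
  by apply: ler_pM; rewrite ?sqr_sum_le_card // sumr_ge0 // => a _; rewrite sqr_ge0.
have S4 : S ^+ 4 <= (delta * n ^+ 2) ^+ 4.
  rewrite (_ : S ^+ 4 = (S ^+ 2) ^+ 2); last by ring.
  apply: le_trans (_ : (n * Q) ^+ 2 <= _).
    by rewrite lerXn2r // nnegrE ?sqr_ge0 // (le_trans _ S2) ?sqr_ge0.
  rewrite exprMn; apply: le_trans (_ : n ^+ 2 * (n ^+ 2 * (delta ^+ 4 * n ^+ 4)) <= _).
    by rewrite ler_wpM2l ?sqr_ge0 // (le_trans Q2) // ler_wpM2l ?sqr_ge0.
  by rewrite le_eqVlt; apply/orP; left; apply/eqP; ring.
rewrite -(@ler_pXn2r _ 4) // ?nnegrE ?mulr_ge0 ?exprn_ge0 //.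
rewrite -normrX (_ : S ^+ 4 = (S ^+ 2) ^+ 2) ?normrX ?real_normK ?num_real //.
  by rewrite -exprM.
by ring.
Qed.


(** The total weight of the maps [f], where the pair [x y] contributes [U] and
    the rest splits into a factor blind to [f y] and one blind to [f x].  Freezing
    [f] outside [x] and [y] and resampling these two values turns it into an
    average of the bilinear sums of [cut_le_C4_norm]. *)
Lemma sum_one_edge_le (V : finType) U (delta : R) (x y : V)
    (P1 P2 : {ffun V -> T} -> R) :
  0 <= delta -> C4_norm U <= delta ^+ 4 * #|T|%:R ^+ 4 -> x != y ->
  (forall f, `|P1 f| <= 1) -> (forall f, `|P2 f| <= 1) ->
  (forall f b, P1 (upd f y b) = P1 f) -> (forall f a, P2 (upd f x a) = P2 f) ->
  `|\sum_(f : {ffun V -> T}) U (f x) (f y) * P1 f * P2 f| <= delta * #|T|%:R ^+ #|V|.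
Proof.
move=> d0 UD nxy P11 P21 P1y P2x; set S := \sum_f _.
have [T0|T0] := posnP #|T|.
  rewrite /S big1 ?normr0 ?mulr_ge0 ?exprn_ge0 // => f _.
  by have := fintype0 (f x) T0.
have n0 : 0 < #|T|%:R :> R by rewrite ltr0n.
have -> : S = #|T|%:R ^- 2 * \sum_(f : {ffun V -> T}) \sum_a \sum_b
    U a b * P1 (upd f x a) * P2 (upd f y b).
  pose F (f : {ffun V -> T}) := U (f x) (f y) * P1 f * P2 f.
  have -> : \sum_(f : {ffun V -> T}) \sum_a \sum_b
      U a b * P1 (upd f x a) * P2 (upd f y b) =
      \sum_f \sum_a \sum_b F (upd (upd f x a) y b).
    apply: eq_bigr => f _; apply: eq_bigr => a _; apply: eq_bigr => b _.
    have updC : upd (upd f x a) y b = upd (upd f y b) x a.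
      apply/ffunP => z; rewrite !ffunE; case: eqP => // ->.
      by rewrite eq_sym (negbTE nxy).
    rewrite /F P1y updC P2x !ffunE eqxx eq_sym (negbTE nxy) eqxx; congr *%R.
  rewrite (sum_upd x (fun g => \sum_b F (upd g y b))) sum_upd.
  by rewrite -/S; field; rewrite gt_eqF.
rewrite normrM ger0_norm ?invr_ge0 ?exprn_ge0 // mulrC ler_pdivrMr ?exprn_gt0 //.
apply: le_trans (ler_norm_sum _ _ _) _.
apply: le_trans (_ : \sum_(f : {ffun V -> T}) delta * #|T|%:R ^+ 2 <= _).
  by apply: ler_sum => f _; apply: cut_le_C4_norm.
by rewrite sumr_const card_ffun -[leLHS]mulr_natl natrX le_eqVlt; apply/orP; left;
  apply/eqP; ring.
Qed.

(** Telescoping over the list [s]: writing [W = (W - p) + p] at the first pair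
    gives the same sum for a shorter list, times [p], and an error term covered by
    [sum_one_edge_le].  The increasing function [r] guarantees that no other pair
    of [s] joins the same two points, so that each of the other factors misses one
    of them. *)
Lemma counting_lemma (V : finType) W (p delta : R) (r : V -> nat)
    (s : seq (V * V)) :
  0 <= p <= 1 -> (forall a b, 0 <= W a b <= 1) ->
  0 <= delta -> C4_norm (fun a b => W a b - p) <= delta ^+ 4 * #|T|%:R ^+ 4 ->
  uniq s -> (forall z, z \in s -> (r z.1 < r z.2)%N) ->
  `|\sum_(f : {ffun V -> T}) \prod_(z <- s) W (f z.1) (f z.2)
     - p ^+ size s * #|T|%:R ^+ #|V| | <= (size s)%:R * delta * #|T|%:R ^+ #|V|.
Proof.
move=> /andP[p0 p1] W01 d0 UD.
elim: s => [_ _|z s IHs /= /andP[zs us] rs].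
  under eq_bigr do rewrite big_nil.
  by rewrite sumr_const card_ffun natrX mul1r subrr normr0 !mul0r.
have {IHs}IHs := IHs us (fun w ws => rs w (mem_behead (s := z :: s) ws)).
have rz : (r z.1 < r z.2)%N by apply: rs; rewrite mem_head.
have prod01 (Q : pred (V * V)) (f : {ffun V -> T}) :
    `|\prod_(w <- s | Q w) W (f w.1) (f w.2)| <= 1.
  apply: (big_ind (fun x : R => `|x| <= 1)) => [|u v u1 v1|w _].
  - by rewrite normr1.
  - by rewrite normrM mulr_ile1.
  - by have /andP[w0 w1] := W01 (f w.1) (f w.2); rewrite ger0_norm.
(* The factors that involve [z.2]; by the ordering they do not involve [z.1]. *)
pose at2 (w : V * V) := (w.1 == z.2) || (w.2 == z.2).
pose P1 (f : {ffun V -> T}) := \prod_(w <- s | ~~ at2 w) W (f w.1) (f w.2).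
pose P2 (f : {ffun V -> T}) := \prod_(w <- s | at2 w) W (f w.1) (f w.2).
have edge : `|\sum_(f : {ffun V -> T}) (W (f z.1) (f z.2) - p) * P1 f * P2 f|
            <= delta * #|T|%:R ^+ #|V|.
  apply: (sum_one_edge_le d0 UD).
  - by apply: contraTneq rz => ->; rewrite ltnn.
  - exact: prod01.
  - exact: prod01.
  - move=> f b; apply: eq_bigr => w; rewrite /at2 negb_or => /andP[/negbTE w1 /negbTE w2].
    by rewrite !ffunE w1 w2.
  - move=> f a; rewrite /P2 big_seq_cond [RHS]big_seq_cond.
    apply: eq_bigr => w /andP[ws wz].
    have rw : (r w.1 < r w.2)%N by apply: rs; rewrite inE ws orbT.
    have [n1 n2] : w.1 != z.1 /\ w.2 != z.1.
      split; apply/eqP => e; move: wz rw rz zs ws; case: w e => w1 w2 /= ->.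
        rewrite /at2 /= => /orP[/eqP->|/eqP->]; first by rewrite ltnn.
        by rewrite -surjective_pairing => _ _ /negP.
      rewrite /at2 /= => /orP[/eqP->|/eqP->]; last by rewrite ltnn.
      by move=> /ltn_trans /[apply]; rewrite ltnn.
    by rewrite !ffunE (negbTE n1) (negbTE n2).
have -> : \sum_(f : {ffun V -> T}) \prod_(w <- z :: s) W (f w.1) (f w.2) =
    \sum_(f : {ffun V -> T}) (W (f z.1) (f z.2) - p) * P1 f * P2 f +
    p * \sum_(f : {ffun V -> T}) \prod_(w <- s) W (f w.1) (f w.2).
  rewrite mulr_sumr -big_split /=; apply: eq_bigr => f _.
  rewrite big_cons (bigID at2) /= -/(P1 f) -/(P2 f); ring.
set A := \sum_f _ in edge *; set B := \sum_f _ in IHs *.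
rewrite (_ : _ - _ = A + p * (B - p ^+ size s * #|T|%:R ^+ #|V|)); last by rewrite exprS; ring.
apply: le_trans (ler_normD _ _) _.
rewrite -add1n natrD -mulrA mulrDl mul1r mulrA; apply: lerD => //.
rewrite normrM ger0_norm // -[leRHS]mul1r; apply: ler_pM => //.
Qed.

End CountingLemma.

(** * Complete bipartite graphs and their counts *)

Section CompleteBipartite.
Variables s t : nat.

Definition is_left (x : 'I_s + 'I_t) : bool := if x is inl _ then true else false.

Definition K_adj : rel ('I_s + 'I_t) := fun x y => is_left x != is_left y.

Lemma K_adj_sym : symmetric K_adj.
Proof. by move=> x y; rewrite /K_adj eq_sym. Qed.

Lemma K_adj_irrefl : irreflexive K_adj.
Proof. by move=> x; rewrite /K_adj eqxx. Qed.

Definition K : sgraph := SGraph K_adj_sym K_adj_irrefl.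

Lemma card_K : #|K| = (s + t)%N.
Proof. by rewrite card_sum !card_ord. Qed.

Lemma card_edges_K : #|edges K| = (s * t)%N.
Proof.
pose e (u : 'I_s * 'I_t) : {set K} := [set inl u.1; inr u.2]%SET.
have inj : injective e.
  move=> [i j] [i' j'] /setP eq_e.
  have := eq_e (inl i); have := eq_e (inr j).
  by rewrite !inE !eqxx !orbT /= orbF => /esym/eqP[<-] /esym/eqP[<-].
rewrite -[s in RHS]card_ord -[t in RHS]card_ord -card_prod -(card_imset _ inj).
congr #|pred_of_set _|; apply/setP => E; apply/imset2P/imsetP.
- move=> [[i|j] [i'|j'] //= _ _ ->]; first by exists (i, j').
  by exists (i', j); rewrite // /e finset.setUC.
- by move=> [[i j] _ ->]; exists (inl i) (inr j).
Qed.

Lemma connected_K : (0 < s)%N -> (0 < t)%N -> connected_graph K.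
Proof.
move=> s0 t0; split; first by rewrite card_K addn_gt0 s0.
have lr i j : connect (@adj K) (inl i) (inr j) by apply: connect1.
have rl i j : connect (@adj K) (inr j) (inl i) by apply: connect1.
move=> [i|j] [i'|j'] //.
- exact: connect_trans (lr i (Ordinal t0)) (rl _ _).
- exact: connect_trans (rl (Ordinal s0) j) (lr _ _).
Qed.

(** A homomorphism is a choice of images for the left side, followed by [t]
    independent choices of a common neighbour of these images. *)
Lemma hom_count_K (R : realType) (G : sgraph) :
  (hom_count K G)%:R =
  \sum_(f : {ffun 'I_s -> G}) (\sum_b \prod_i (adj (f i) b)%:R) ^+ t :> R.
Proof.
pose join (u : {ffun 'I_s -> G} * {ffun 'I_t -> G}) : {ffun K -> G} :=
  [ffun x => match x with inl i => u.1 i | inr j => u.2 j end].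
pose split (f : {ffun K -> G}) : {ffun 'I_s -> G} * {ffun 'I_t -> G} :=
  ([ffun i => f (inl i)], [ffun j => f (inr j)]).
have join_bij : bijective join.
  exists split => [[f g]|f].
    by congr pair; apply/ffunP => i; rewrite !ffunE.
  by apply/ffunP => -[i|j]; rewrite !ffunE.
have homE u : (is_graph_hom (join u))%:R =
    \prod_j \prod_i (adj (u.1 i) (u.2 j))%:R :> R.
  have [h|] := boolP (is_graph_hom (join u)).
    rewrite big1 // => j _; rewrite big1 // => i _.
    by move/forallP/(_ (inl i))/forallP/(_ (inr j)): h; rewrite !ffunE => /implyP->.
  rewrite negb_forall => /existsP[x]; rewrite negb_forall => /existsP[y].
  rewrite negb_imply => /andP[].
  case: x y => [i|j] [i'|j'] //= _; rewrite !ffunE => /negbTE a0.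
  - by rewrite (bigD1 j') // (bigD1 i) //= a0 !mul0r.
  - by rewrite (bigD1 j) // (bigD1 i') //= adj_sym a0 !mul0r.
rewrite /hom_count -sum1dep_card natr_sum big_mkcond /=.
rewrite (reindex join) /=; last exact: onW_bij.
rewrite (eq_bigr (fun u : {ffun 'I_s -> G} * {ffun 'I_t -> G} =>
  \prod_j \prod_i (adj (u.1 i) (u.2 j))%:R)); last first.
  by move=> u _; rewrite -homE; case: is_graph_hom.
rewrite -(pair_big xpredT xpredT (fun (f : {ffun 'I_s -> G}) (g : {ffun 'I_t -> G}) =>
  \prod_j \prod_i (adj (f i) (g j))%:R)) /=.
apply: eq_bigr => f _.
rewrite -(bigA_distr_bigA (fun _ b => \prod_i (adj (f i) b)%:R)) /=.
by rewrite prodr_const card_ord.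
Qed.

End CompleteBipartite.

Lemma hom_count_star (R : realType) (t : nat) (G : sgraph) :
  (hom_count (K 1 t) G)%:R = \sum_(a : G) (\sum_(b : G) (adj a b)%:R) ^+ t :> R.
Proof.
rewrite hom_count_K (reindex (fun a : G => [ffun => a])) /=.
  apply: eq_bigr => a _; congr (_ ^+ t).
  by apply: eq_bigr => b _; rewrite big_ord1 ffunE.
exists (fun f : {ffun 'I_1 -> G} => f ord0) => [a|f] _; first by rewrite ffunE.
by apply/ffunP => i; rewrite ffunE (ord1 i).
Qed.

Lemma hom_count_C4 (R : realType) (G : sgraph) :
  (hom_count (K 2 2) G)%:R =
  \sum_(a : G) \sum_(a' : G) (\sum_(b : G) (adj a b)%:R * (adj a' b)%:R) ^+ 2 :> R.
Proof.
rewrite hom_count_K pair_big /=.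
rewrite (reindex (fun u : G * G => [ffun i : 'I_2 => if i == ord0 then u.1 else u.2])) /=.
  apply: eq_bigr => a _; congr (_ ^+ 2).
  by apply: eq_bigr => b _; rewrite big_ord_recl big_ord1 !ffunE.
exists (fun f : {ffun 'I_2 -> G} => (f ord0, f ord_max)) => [[a a']|f] _.
  by rewrite !ffunE.
apply/ffunP => i; rewrite ffunE; case: eqP => [->//|i0] /=.
congr (f _); apply: val_inj => /=; have := ltn_ord i.
have : i <> 0%N :> nat by move=> i0'; apply: i0; apply: val_inj.
by move: (nat_of_ord i) => k; lia.
Qed.

(** * The triple is forcing *)

Section Forcing.
Variable R : realType.

(** Let [x] be the normalised degrees and [k] the normalised codegrees of [G].
    The kernel of [A - p] is [(k a a' - p ^+ 2) - p * (x a - p) - p * (x a' - p)],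
    whence the factor 3.  The mean of [k] is that of [x ^+ 2], so after expansion
    only the mean of [k ^+ 2], which is the 4-cycle density, and the mean of
    [3 * p ^+ 4 - 4 * p ^+ 3 * x] are left.  The latter is at most that of
    [- x ^+ 4 + 3 / p ^+ 4 * (x ^+ 4 - p ^+ 4) ^+ 2], where the star densities
    appear.  The right-hand side has been chosen to tend to 0 under the asymptotics
    of the three counts. *)
Lemma C4_norm_le_counts (G : sgraph) (p : R) : 0 < p -> (0 < #|G|)%N ->
  C4_norm (fun a b : G => (adj a b)%:R - p) <=
  3 * ((hom_count (K 2 2) G)%:R / #|G|%:R ^+ 4
       - (hom_count (K 1 4) G)%:R / #|G|%:R ^+ 5
       + 3 / p ^+ 4 * ((hom_count (K 1 8) G)%:R / #|G|%:R ^+ 9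
         - 2 * p ^+ 4 * ((hom_count (K 1 4) G)%:R / #|G|%:R ^+ 5) + p ^+ 8))
  * #|G|%:R ^+ 4.
Proof.
move=> p0 G0; rewrite !hom_count_star hom_count_C4.
set n : R := #|G|%:R.
have n0 : 0 < n by rewrite ltr0n.
have nn0 : n != 0 by rewrite gt_eqF.
have pn0 : p != 0 by rewrite gt_eqF.
pose A (a b : G) : R := (adj a b)%:R.
pose x a := (\sum_b A a b) / n; pose k a a' := \sum_b A a b * A a' b.
have xE a : \sum_b A a b = n * x a by rewrite /x mulrC divfK.
have x0 a : 0 <= x a by rewrite /x divr_ge0 ?sumr_ge0 // ltW.
have sumk : \sum_a \sum_a' k a a' = n ^+ 2 * \sum_a x a ^+ 2.
  rewrite /k; under eq_bigr do rewrite exchange_big /=.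
  rewrite exchange_big mulr_sumr; apply: eq_bigr => b _ /=.
  under eq_bigr do rewrite -mulr_sumr.
  rewrite -mulr_suml -exprMn -xE expr2.
  by congr (_ * _); apply: eq_bigr => a _; rewrite /A adj_sym.
have cst (c : R) : \sum_(a : G) c = n * c by rewrite sumr_const mulr_natl.
have UU a a' : \sum_b (A a b - p) * (A a' b - p) =
    k a a' - n * (p * x a + p * x a' - p ^+ 2).
  rewrite (eq_bigr (fun b => A a b * A a' b - p * A a b - p * A a' b + p ^+ 2)).
    by rewrite big_split !sumrB cst -!mulr_sumr !xE /= -/(k a a'); ring.
  by move=> b _; ring.
have le1 : C4_norm (fun a b => A a b - p) <=
    3 * (\sum_a \sum_a' k a a' ^+ 2 + n ^+ 3 * \sum_a (3 * p ^+ 4 - 4 * p ^+ 3 * x a)).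
  apply: (@le_trans _ _ (\sum_a \sum_a' 3 * (k a a' ^+ 2 - (2 * n * p ^+ 2) * k a a'
     + n ^+ 2 * (p ^+ 4 + p ^+ 2 * (x a - p) ^+ 2 + p ^+ 2 * (x a' - p) ^+ 2)))).
    apply: ler_sum => a _; apply: ler_sum => a' _; rewrite UU.
    set u := k a a' - n * p ^+ 2; set v := n * p * (x a - p); set w := n * p * (x a' - p).
    have -> : k a a' - n * (p * x a + p * x a' - p ^+ 2) = u - v - w by rewrite /u /v /w; ring.
    rewrite (_ : 3 * _ = 3 * (u ^+ 2 + v ^+ 2 + w ^+ 2)); last by rewrite /u /v /w; ring.
    have := sqr_ge0 (u + v); have := sqr_ge0 (u + w); have := sqr_ge0 (v - w).
    by nra.
  under eq_bigr do rewrite -mulr_sumr.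
  rewrite -mulr_sumr ler_pM2l //.
  have sqE : \sum_a (x a - p) ^+ 2 = \sum_a x a ^+ 2 - 2 * p * \sum_a x a + n * p ^+ 2.
    rewrite -cst mulr_sumr -sumrB -big_split /=.
    by apply: eq_bigr => a _; ring.
  rewrite (eq_bigr (fun a => \sum_a' k a a' ^+ 2 - 2 * n * p ^+ 2 * \sum_a' k a a' +
    (n ^+ 3 * p ^+ 2 * (x a - p) ^+ 2 +
     (n ^+ 3 * p ^+ 4 + n ^+ 2 * p ^+ 2 * \sum_a' (x a' - p) ^+ 2)))); last first.
    by move=> a _; rewrite !big_split /= sumrN -!mulr_sumr !big_split /= !cst -mulr_sumr; ring.
  rewrite sumrB cst -!mulr_sumr.
  rewrite big_split sumrB -mulr_sumr sumk /= big_split /= cst -mulr_sumr sqE.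
  by rewrite le_eqVlt; apply/orP; left; apply/eqP; ring.
(* [p - (p ^+ 4 - x ^+ 4) / (4 * p ^+ 3)] is the tangent to the fourth root of
   [x ^+ 4] at [p ^+ 4]; the square compensates for the concavity of the root. *)
have le2 : \sum_a (3 * p ^+ 4 - 4 * p ^+ 3 * x a) <=
    \sum_a (- x a ^+ 4 + 3 / p ^+ 4 * (x a ^+ 8 - 2 * p ^+ 4 * x a ^+ 4 + p ^+ 8)).
  apply: ler_sum => a _; have xa := x0 a.
  rewrite -(@ler_pM2l _ (p ^+ 4)) ?exprn_gt0 // -subr_ge0.
  have -> : p ^+ 4 * (- x a ^+ 4 + 3 / p ^+ 4 * (x a ^+ 8 - 2 * p ^+ 4 * x a ^+ 4 + p ^+ 8))
    - p ^+ 4 * (3 * p ^+ 4 - 4 * p ^+ 3 * x a) =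
    (x a - p) ^+ 2 * (3 * ((x a + p) * (x a ^+ 2 + p ^+ 2)) ^+ 2
       - p ^+ 4 * (x a ^+ 2 + 2 * p * x a + 3 * p ^+ 2)) by field.
  apply: mulr_ge0; first exact: sqr_ge0.
  rewrite (_ : _ - _ = x a ^+ 2 * (3 * (x a + p) ^+ 2 * (x a ^+ 2 + 2 * p ^+ 2)) +
    p ^+ 4 * (2 * x a ^+ 2 + 4 * p * x a)); last by ring.
  have p0' := ltW p0.
  by repeat (done || apply: sqr_ge0 || apply: exprn_ge0 || apply: mulr_ge0 || apply: addr_ge0).
have degE t : \sum_a (\sum_b A a b) ^+ t = n ^+ t * \sum_a x a ^+ t.
  by rewrite mulr_sumr; apply: eq_bigr => a _; rewrite xE exprMn.
apply: le_trans le1 _.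
apply: le_trans (_ : 3 * (\sum_a \sum_a' k a a' ^+ 2 + n ^+ 3 *
   \sum_a (- x a ^+ 4 + 3 / p ^+ 4 * (x a ^+ 8 - 2 * p ^+ 4 * x a ^+ 4 + p ^+ 8))) <= _).
  by rewrite ler_pM2l // lerD2l ler_pM2l ?exprn_gt0.
rewrite big_split /= sumrN -mulr_sumr big_split sumrB /= -mulr_sumr cst.
rewrite -/A !degE le_eqVlt; apply/orP; left; apply/eqP.
by field; rewrite nn0 pn0.
Qed.

Lemma hom_count_le_C4_norm (G : sgraph) (H : sgraph) (p delta : R) :
  0 < p < 1 -> 0 <= delta ->
  C4_norm (fun a b : G => (adj a b)%:R - p) <= delta ^+ 4 * #|G|%:R ^+ 4 ->
  `|(hom_count H G)%:R - p ^+ #|edges H| * #|G|%:R ^+ #|H| | <=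
    #|edges H|%:R * delta * #|G|%:R ^+ #|H|.
Proof.
move=> /andP[p0 p1] d0 UD; rewrite hom_count_sum card_edges cardE.
apply: (@counting_lemma _ _ _ (fun a b => (adj a b)%:R) p delta
          (fun x => enum_rank x)) => //.
- by rewrite (ltW p0) (ltW p1).
- by move=> a b; case: adj; rewrite ?lexx ?ler01.
- exact: enum_uniq.
- by move=> z; rewrite mem_enum inE => /andP[].
Qed.

Lemma forcing_stars_C4 :
  forcing R (fun H => [\/ H = K 1 4, H = K 1 8 | H = K 2 2]).
Proof.
move=> G cardG p p01 asym H; have /andP[p0 p1] := p01.
have := asym (K 1 4) (Or31 _ _ erefl).
have := asym (K 1 8) (Or32 _ _ erefl).
have := asym (K 2 2) (Or33 _ _ erefl).
rewrite /hom_asymp !card_edges_K !card_K => c_cvg s8_cvg s4_cvg.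
pose u n : R := 3 * ((hom_count (K 2 2) (G n))%:R / n%:R ^+ 4
       - (hom_count (K 1 4) (G n))%:R / n%:R ^+ 5
       + 3 / p ^+ 4 * ((hom_count (K 1 8) (G n))%:R / n%:R ^+ 9
         - 2 * p ^+ 4 * ((hom_count (K 1 4) (G n))%:R / n%:R ^+ 5) + p ^+ 8)).
have u0 : u n @[n --> \oo] --> (0 : R).
  have -> : (0 : R) = 3 * (p ^+ 4 - p ^+ 4
     + 3 / p ^+ 4 * (p ^+ 8 - 2 * p ^+ 4 * p ^+ 4 + p ^+ 8)) by ring.
  apply: cvgMr; apply: cvgD; first exact: cvgB.
  apply: cvgMr; apply: cvgD; last exact: cvg_cst.
  by apply: cvgB => //; apply: cvgMr.
apply/cvgrPdist_le => eps eps0; set e := #|edges H|.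
pose delta := eps / e.+1%:R; have d0 : 0 < delta by rewrite divr_gt0.
have /cvgrPdist_le /(_ _ (exprn_gt0 4 d0)) := u0.
apply: filter_app; near=> n => un.
have n0 : 0 < n%:R :> R by rewrite ltr0n; near: n; exact: nbhs_infty_gt.
have Gn : (0 < #|G n|)%N by rewrite cardG -(ltr0n R).
have UD : C4_norm (fun a b : G n => (adj a b)%:R - p) <= delta ^+ 4 * #|G n|%:R ^+ 4.
  apply: le_trans (C4_norm_le_counts p0 Gn) _; rewrite cardG -/(u n).
  rewrite ler_pM2r ?exprn_gt0 //; apply: le_trans un.
  by rewrite sub0r normrN ler_norm.
have := hom_count_le_C4_norm H p01 (ltW d0) UD; rewrite cardG -/e.
rewrite distrC => le.
have nh := exprn_gt0 #|H| n0.
rewrite -(ler_pM2r nh) -[X in _ * X <= _](ger0_norm (ltW nh)) -normrM mulrBl.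
rewrite divfK ?expf_neq0 ?gt_eqF //.
apply: le_trans le _; rewrite ler_pM2r ?exprn_gt0 // /delta mulrCA ger_pMr //.
by rewrite ler_pdivrMr // mul1r ler_nat.
Unshelve. all: by end_near.
Qed.

End Forcing.

(** * Complete bipartite graphs with isolated vertices *)

Section TwoPartGraph.
Variables n alpha beta : nat.

Definition part1 (i : 'I_n) : bool := (i < alpha)%N.
Definition part2 (i : 'I_n) : bool := (alpha <= i < alpha + beta)%N.

Definition two_part_adj : rel 'I_n :=
  fun i j => part1 i && part2 j || part2 i && part1 j.

Lemma part12_disjoint i : part1 i -> part2 i = false.
Proof. by rewrite /part1 /part2 ltnNge => /negbTE ->. Qed.

Lemma two_part_adj_sym : symmetric two_part_adj.
Proof. by move=> i j; rewrite /two_part_adj orbC andbC [part2 j && _]andbC. Qed.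

Lemma two_part_adj_irrefl : irreflexive two_part_adj.
Proof.
move=> i; rewrite /two_part_adj [part2 i && _]andbC orbb.
by apply/negbTE/negP => /andP[/part12_disjoint ->].
Qed.

Definition two_part_graph : sgraph := SGraph two_part_adj_sym two_part_adj_irrefl.

Hypothesis parts_fit : (alpha + beta <= n)%N.

Lemma sum_below (R : realType) (m : nat) : (m <= n)%N ->
  \sum_(i < n) (i < m)%N%:R = m%:R :> R.
Proof.
move=> mn; have -> : m%:R = \sum_(i < m) 1 :> R by rewrite sumr_const card_ord.
by rewrite (big_ord_widen n (fun=> 1)) // [RHS]big_mkcond /=; apply: eq_bigr => i _; case: ifP.
Qed.

Lemma sum_part1 (R : realType) : \sum_i (part1 i)%:R = alpha%:R :> R.
Proof. exact/sum_below/(leq_trans (leq_addr _ _) parts_fit). Qed.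

Lemma sum_part2 (R : realType) : \sum_i (part2 i)%:R = beta%:R :> R.
Proof.
apply: (addrI alpha%:R); rewrite -natrD -(sum_below _ parts_fit) -sum_part1 -big_split.
apply: eq_bigr => i _; rewrite /part1 /part2 /=.
by case: ltnP => h; rewrite /= ?add0r // ltn_addr // addr0.
Qed.

(** Each side of [K s t] goes into one part and the other side into the other
    part.  This needs both sides to be non-empty: otherwise [K s t] has no edges
    and its vertices can go anywhere. *)
Lemma hom_count_two_part (R : realType) (s t : nat) : (0 < s)%N -> (0 < t)%N ->
  (hom_count (K s t) two_part_graph)%:R =
  alpha%:R ^+ s * beta%:R ^+ t + beta%:R ^+ s * alpha%:R ^+ t :> R.
Proof.
move=> s0 t0; rewrite hom_count_K.
pose X (f : {ffun 'I_s -> 'I_n}) : R := \prod_i (part1 (f i))%:R.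
pose Y (f : {ffun 'I_s -> 'I_n}) : R := \prod_i (part2 (f i))%:R.
have prodb (Q : pred 'I_n) (f : {ffun 'I_s -> 'I_n}) :
    \prod_i (Q (f i))%:R = [forall i, Q (f i)]%:R :> R.
  case: forallP => [h|/forallP]; first by rewrite big1 // => i _; rewrite h.
  by rewrite negb_forall => /existsP[i /negbTE Qi]; rewrite (bigD1 i) //= Qi mul0r.
have nbr (f : {ffun 'I_s -> 'I_n}) :
    (\sum_(b : two_part_graph) \prod_i (adj (f i : two_part_graph) b)%:R) ^+ t =
    X f * beta%:R ^+ t + Y f * alpha%:R ^+ t.
  have -> : \sum_(b : two_part_graph) \prod_i (adj (f i : two_part_graph) b)%:R =
      X f * beta%:R + Y f * alpha%:R.
    rewrite -sum_part1 -sum_part2 !mulr_sumr -big_split /=.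
    apply: eq_bigr => b _; rewrite /X /Y /two_part_adj.
    have [b1|b1] := boolP (part1 b).
      rewrite (part12_disjoint b1) mulr0 add0r mulr1.
      by apply: eq_bigr => i _; rewrite andbF andbT.
    rewrite mulr0 addr0; have [b2|b2] := boolP (part2 b).
      by rewrite mulr1; apply: eq_bigr => i _; rewrite andbF andbT orbF.
    by rewrite mulr0 (bigD1 (Ordinal s0)) //= !andbF mul0r.
  rewrite /X /Y !prodb.
  case: forallP => [h1|_]; case: forallP => [h2|_]; rewrite ?mul0r ?mul1r ?add0r ?addr0 //.
    by have := h2 (Ordinal s0); rewrite part12_disjoint.
  by rewrite expr0n (gtn_eqF t0).
under eq_bigr do rewrite nbr.
rewrite big_split /= -!mulr_suml; congr (_ * _ + _ * _).
  rewrite -(bigA_distr_bigA (fun _ a => (part1 a)%:R)) /=.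
  by rewrite prodr_const card_ord sum_part1.
rewrite -(bigA_distr_bigA (fun _ a => (part2 a)%:R)) /=.
by rewrite prodr_const card_ord sum_part2.
Qed.

End TwoPartGraph.

(** * No pair is forcing *)

Section NonForcing.
Variables (R : realType) (a b : R).
Hypotheses (a0 : 0 <= a) (b0 : 0 <= b) (ab1 : a + b <= 1).

Definition two_part_seq (n : nat) : sgraph :=
  two_part_graph n (Num.truncn (a * n%:R)) (Num.truncn (b * n%:R)).

Lemma truncn_asymp (c : R) : 0 <= c ->
  (Num.truncn (c * n%:R))%:R / n%:R @[n --> \oo] --> c.
Proof.
move=> c0.
apply: (@squeeze_cvgr _ _ _ _ (fun n => c - n%:R^-1) (fun n => c)).
- near=> n.
  have n0 : 0 < n%:R :> R by rewrite ltr0n; near: n; exact: nbhs_infty_gt.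
  have cn0 : 0 <= c * n%:R by rewrite mulr_ge0 // ltW.
  have /andP[le lt] := truncn_itv cn0.
  rewrite ler_pdivlMr // ler_pdivrMr // le andbT.
  rewrite mulrBl mulVf ?gt_eqF // lerBlDr.
  by rewrite -natr1 in lt; exact: ltW.
- rewrite -[X in _ --> X]subr0; apply: cvgB; first exact: cvg_cst.
  apply/gtr0_cvgV0; last exact: cvgr_idn.
  by near=> n; rewrite ltr0n; near: n; exact: nbhs_infty_gt.
- exact: cvg_cst.
Unshelve. all: by end_near.
Qed.

Lemma two_part_seq_asymp (s t : nat) : (0 < s)%N -> (0 < t)%N ->
  hom_asymp (K s t) two_part_seq (a ^+ s * b ^+ t + b ^+ s * a ^+ t).
Proof.
move=> s0 t0; rewrite /hom_asymp card_K.
pose al n : R := (Num.truncn (a * n%:R))%:R / n%:R.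
pose be n : R := (Num.truncn (b * n%:R))%:R / n%:R.
have aux (x : nat -> R) (l : R) k : x n @[n --> \oo] --> l -> x n ^+ k @[n --> \oo] --> l ^+ k.
  move=> xl; elim: k => [|k IHk]; first exact: cvg_cst.
  by under eq_fun do rewrite exprS; rewrite exprS; apply: cvgM.
rewrite (_ : (fun n => _) = (fun n => al n ^+ s * be n ^+ t + be n ^+ s * al n ^+ t)).
  apply: cvgD; apply: cvgM; apply: aux; exact: truncn_asymp.
apply/funext => n; rewrite hom_count_two_part //.
  by rewrite /al /be !exprMn !exprVn exprD invfM; ring.
rewrite -(ler_nat R) natrD.
apply: le_trans (_ : a * n%:R + b * n%:R <= _).
  by apply: lerD; rewrite truncn_le mulr_ge0.
by rewrite -mulrDl ler_piMl.
Qed.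

End NonForcing.

(** The last hypothesis on [a] and [b] says that the density of [K s t] is not
    the quasirandom one; this is what refutes forcing. *)
Lemma not_forcing_of_two_part (R : realType) (a b p : R) (H1 H2 : sgraph) (s t : nat) :
  0 <= a -> 0 <= b -> a + b <= 1 -> 0 < p < 1 ->
  hom_asymp H1 (two_part_seq a b) (p ^+ #|edges H1|) ->
  hom_asymp H2 (two_part_seq a b) (p ^+ #|edges H2|) ->
  (0 < s)%N -> (0 < t)%N ->
  a ^+ s * b ^+ t + b ^+ s * a ^+ t != p ^+ (s * t) ->
  ~ forcing R (fun H => H = H1 \/ H = H2).
Proof.
move=> a0 b0 ab1 p01 asym1 asym2 s0 t0 /eqP neq force; apply: neq.
have cardG n : #|two_part_seq a b n| = n by rewrite card_ord.
have qr : quasirandom p (two_part_seq a b) by apply: force => // H [] ->.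
have := qr (K s t); rewrite /hom_asymp card_edges_K.
exact: (cvg_unique (@Rhausdorff R) (two_part_seq_asymp a0 b0 ab1 s0 t0)).
Qed.

(** The 4-cycle fixes [p] by [p ^+ 4 = 2 * (a * b) ^+ 2], and the equation on [a]
    and [b] says that the star has density [p ^+ (4 * j)].  The edge density
    [2 * (a * b)] cannot be [p]: this would mean [(a * b) ^+ 2 = 1/8], but
    [a + b <= 1] gives [a * b <= 1/4]. *)
Lemma not_forcing_star_C4 (R : realType) (j : nat) (a b : R) :
  (0 < j)%N -> 0 < a -> 0 < b -> a + b <= 1 ->
  a * b ^+ (4 * j) + b * a ^+ (4 * j) = (2 * (a * b) ^+ 2) ^+ j ->
  ~ forcing R (fun H => H = K 1 (4 * j) \/ H = K 2 2).
Proof.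
move=> j0 a0 b0 ab1 starE.
have m0 : 0 < a * b by rewrite mulr_gt0.
have m1 : a * b <= 4^-1.
  have sum1 : (a + b) ^+ 2 <= 1 by rewrite expr_le1 // ltW // addr_gt0.
  have := sqr_ge0 (a - b); lra.
pose p := Num.sqrt (Num.sqrt (2 * (a * b) ^+ 2)).
have p4 : p ^+ 4 = 2 * (a * b) ^+ 2.
  by rewrite (exprM p 2 2) !sqr_sqrtr ?sqrtr_ge0 // mulr_ge0 ?sqr_ge0.
have p0 : 0 < p by rewrite !sqrtr_gt0 mulr_gt0 ?exprn_gt0.
have p1 : p < 1 by rewrite -(@expr_lt1 _ 4) ?ltW // p4; nra.
apply: (@not_forcing_of_two_part _ a b p _ _ 1 1) => //; rewrite ?p0 // ?ltW //.
- rewrite card_edges_K mul1n exprM p4 -starE -{1}[a]expr1 -{2}[b]expr1.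
  by apply: two_part_seq_asymp; rewrite ?muln_gt0 // ltW.
- rewrite card_edges_K p4 (_ : 2 * _ = a ^+ 2 * b ^+ 2 + b ^+ 2 * a ^+ 2); last by ring.
  by apply: two_part_seq_asymp; rewrite // ltW.
- apply/eqP => /(congr1 (fun x => x ^+ 4)); rewrite /= expr1 p4 => e.
  have m2 : 0 < (a * b) ^+ 2 by rewrite exprn_gt0.
  have m4 : (a * b) ^+ 2 <= 16^-1 by nra.
  suff : 16 * (a * b) ^+ 2 * (a * b) ^+ 2 = 2 * (a * b) ^+ 2 by nra.
  by rewrite -e; ring.
Qed.

(** In the balanced complete bipartite graph the stars have the right density
    for [p = 1/2], but the 4-cycle has density 1/8. *)
Lemma not_forcing_stars (R : realType) (k l : nat) : (0 < k)%N -> (0 < l)%N ->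
  ~ forcing R (fun H => H = K 1 k \/ H = K 1 l).
Proof.
move=> k0 l0; pose h : R := 2^-1.
have h0 : 0 <= h by rewrite invr_ge0.
have hh1 : h + h <= 1 by rewrite /h; lra.
have star m : (0 < m)%N -> hom_asymp (K 1 m) (two_part_seq h h) (h ^+ #|edges (K 1 m)|).
  move=> m0; rewrite card_edges_K mul1n.
  rewrite (_ : h ^+ m = h ^+ 1 * h ^+ m + h ^+ 1 * h ^+ m); last by rewrite /h; field.
  exact: two_part_seq_asymp.
apply: (@not_forcing_of_two_part _ h h h _ _ 2 2) => //; try exact: star.
  by rewrite /h; lra.
by rewrite /h; lra.
Qed.

Lemma not_iso_card (H G : sgraph) : #|H| != #|G| -> ~ graph_iso H G.
Proof. by move=> /eqP ne [f [/bij_eq_card ? _]]. Qed.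

Theorem theorem1p2 (R : realType) :
  exists H1 H2 H3 : sgraph,
    [/\ connected_graph H1, connected_graph H2 & connected_graph H3] /\
    [/\ ~ graph_iso H1 H2, ~ graph_iso H1 H3 & ~ graph_iso H2 H3] /\
    forcing R (fun H => [\/ H = H1, H = H2 | H = H3]) /\
    [/\ ~ forcing R (fun H => H = H1 \/ H = H2),
        ~ forcing R (fun H => H = H1 \/ H = H3)
      & ~ forcing R (fun H => H = H2 \/ H = H3)].
Proof.
exists (K 1 4), (K 1 8), (K 2 2); split; [|split; [|split]].
- by split; apply: connected_K.
- by split; apply: not_iso_card; rewrite !card_K.
- exact: forcing_stars_C4.
- split; first exact: not_forcing_stars.
  + apply: (@not_forcing_star_C4 R 1 (3 / 14) (9 / 14)) => //; try lra; by field.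
  + pose a : R := 27 / 547; have aE : 547 * a = 27 by rewrite /a; field.
    (* Only this equation is kept, so that no large powers are computed. *)
    move: a aE => a aE.
    apply: (@not_forcing_star_C4 R 2 a (3 * a)) => //; try lra.
    transitivity (12 * (547 * a) * a ^+ 8); first by ring.
    by rewrite aE; ring.
Qed.
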